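(* Over ZF, the axiom of choice is equivalent to the statement: every partial order $(\mathbb{P},\unlhd)$ contains a maximal antichain (in the sense of incompatibility).
   Context: Let $(\mathbb{P},\unlhd)$ be a partial order. Elements $p,q\in\mathbb{P}$ are compatible iff there exists $r\in\mathbb{P}$ with $r\unlhd p$ and $r\unlhd q$; otherwise they are incompatible. A subset $A\subseteq\mathbb{P}$ is an antichain iff any two distinct elements of $A$ are incompatible. An antichain $A$ is maximal iff every $p\in\mathbb{P}$ is compatible with some $q\in A$. *)

(* Defs.v *)
From Stdlib Require Import Utf8.

Set Implicit Arguments.
Unset Strict Implicit.

Record set_structure : Type := {
  carrier :> Type;
  mem : carrier -> carrier -> Prop
}.

Arguments mem {_} _ _.

Declare Scope set_structure_scope.
Delimit Scope set_structure_scope with sets.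
Local Open Scope set_structure_scope.

Notation "x ∈ y" := (mem x y) (at level 70) : set_structure_scope.

(** First-order formulas in the language {∈, =}, with de Bruijn indices.  They
    are needed because Separation and Replacement have to be schemas over
    first-order formulas: quantifying over all predicates [M -> Prop] instead
    would give second-order ZF. *)
Inductive formula : Type :=
| FMem (i j : nat)
| FEq (i j : nat)
| FBot
| FImp (φ ψ : formula)
| FAnd (φ ψ : formula)
| FOr (φ ψ : formula)
| FAll (φ : formula)
| FEx (φ : formula).

Definition scons (T : Type) (x : T) (ρ : nat -> T) (n : nat) : T :=
  match n with
  | O => x
  | S k => ρ k
  end.

Fixpoint sat {M : set_structure} (ρ : nat -> M) (φ : formula) : Prop :=
  match φ with
  | FMem i j => ρ i ∈ ρ j
  | FEq i j => ρ i = ρ j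
  | FBot => False
  | FImp φ1 φ2 => sat ρ φ1 -> sat ρ φ2
  | FAnd φ1 φ2 => sat ρ φ1 /\ sat ρ φ2
  | FOr φ1 φ2 => sat ρ φ1 \/ sat ρ φ2
  | FAll φ1 => forall x : M, sat (scons x ρ) φ1
  | FEx φ1 => exists x : M, sat (scons x ρ) φ1
  end.

Definition subset (M : set_structure) (a b : M) : Prop :=
  forall x : M, x ∈ a -> x ∈ b.

Definition is_empty (M : set_structure) (a : M) : Prop :=
  forall x : M, ~ x ∈ a.

Definition is_successor (M : set_structure) (a s : M) : Prop :=
  forall x : M, x ∈ s <-> x ∈ a \/ x = a.

Definition is_upair (M : set_structure) (a b c : M) : Prop :=
  forall x : M, x ∈ c <-> x = a \/ x = b.

(** [p] is the Kuratowski pair {{a}, {a, b}}. *)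
Definition is_opair (M : set_structure) (a b p : M) : Prop :=
  exists s d : M, is_upair a a s /\ is_upair a b d /\ is_upair s d p.

(** In the two schemas the tail [ρ] of the valuation supplies the parameters;
    in Replacement, index 0 is the argument and index 1 the value. *)
Record ZF (M : set_structure) : Prop := {
  ZF_extensionality : forall a b : M,
    (forall x : M, x ∈ a <-> x ∈ b) -> a = b;
  ZF_foundation : forall a : M,
    (exists x : M, x ∈ a) ->
    exists x : M, x ∈ a /\ ~ (exists y : M, y ∈ x /\ y ∈ a);
  ZF_pairing : forall a b : M, exists c : M, is_upair a b c;
  ZF_union : forall a : M, exists u : M,
    forall x : M, x ∈ u <-> exists y : M, y ∈ a /\ x ∈ y;
  ZF_powerset : forall a : M, exists p : M,
    forall x : M, x ∈ p <-> subset x a;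
  ZF_infinity : exists w : M,
    (exists e : M, is_empty e /\ e ∈ w) /\
    (forall x : M, x ∈ w -> exists s : M, is_successor x s /\ s ∈ w);
  ZF_separation : forall (φ : formula) (ρ : nat -> M) (a : M), exists b : M,
    forall x : M, x ∈ b <-> x ∈ a /\ sat (scons x ρ) φ;
  ZF_replacement : forall (φ : formula) (ρ : nat -> M),
    (forall x y z : M,
       sat (scons x (scons y ρ)) φ -> sat (scons x (scons z ρ)) φ -> y = z) ->
    forall a : M, exists b : M,
    forall y : M, y ∈ b <-> exists x : M, x ∈ a /\ sat (scons x (scons y ρ)) φ
}.

(** [(x, y) ∈ R] in the sense of [M]. *)
Definition related (M : set_structure) (R x y : M) : Prop :=
  exists p : M, is_opair x y p /\ p ∈ R.

Definition is_function_on (M : set_structure) (f X : M) : Prop :=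
  (forall p : M, p ∈ f -> exists x y : M, x ∈ X /\ is_opair x y p) /\
  (forall x : M, x ∈ X -> exists! y : M, related f x y).

Definition axiom_of_choice (M : set_structure) : Prop :=
  forall X : M,
    (forall x : M, x ∈ X -> ~ is_empty x) ->
    exists f : M,
      is_function_on f X /\
      (forall x y : M, x ∈ X -> related f x y -> y ∈ x).

(** [L] is a partial order on the (possibly empty) set [P]; [related L p q] is
    p ⊴ q. *)
Definition is_partial_order (M : set_structure) (P L : M) : Prop :=
  (forall z : M, z ∈ L -> exists p q : M, p ∈ P /\ q ∈ P /\ is_opair p q z) /\
  (forall p : M, p ∈ P -> related L p p) /\
  (forall p q : M, p ∈ P -> q ∈ P -> related L p q -> related L q p -> p = q) /\
  (forall p q r : M, p ∈ P -> q ∈ P -> r ∈ P ->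
     related L p q -> related L q r -> related L p r).

Definition compatible (M : set_structure) (P L p q : M) : Prop :=
  exists r : M, r ∈ P /\ related L r p /\ related L r q.

Definition is_antichain (M : set_structure) (P L A : M) : Prop :=
  subset A P /\
  (forall p q : M, p ∈ A -> q ∈ A -> p <> q -> ~ compatible P L p q).

Definition is_maximal_antichain (M : set_structure) (P L A : M) : Prop :=
  is_antichain P L A /\
  (forall p : M, p ∈ P -> exists q : M, q ∈ A /\ compatible P L p q).

Definition maximal_antichain_principle (M : set_structure) : Prop :=
  forall P L : M,
    is_partial_order P L -> exists A : M, is_maximal_antichain P L A.

(* Main.v *)
(** From maximal antichains to choice: on [x × ω] put (a, n) ⊴ (b, m) iff the
    pairs are equal or m < n.  Any two elements have a common lower bound, so
    in the disjoint union of these orders over x ∈ X a maximal antichain meets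
    every summand in exactly one point (x, (a, n)), and x ↦ a is a choice
    function.

    From choice to maximal antichains: a choice function on the nonempty subsets
    of P extends every non-maximal antichain A by one element.  The least family
    of subsets of P closed under this extension step and under arbitrary unions
    is a chain (the Bourbaki–Witt argument), so it consists of antichains; its
    union belongs to it and cannot be extended. *)
From Stdlib Require Import Classical.
Require Import Defs.

Set Implicit Arguments.
Unset Strict Implicit.

Local Open Scope set_structure_scope.

(** * First-order definability *)

(** Separation accepts formulas only, so every predicate that cuts out a set must come with one. The
    closure rules below find it from the shape of the predicate and spare writing de Bruijn
    terms. *)
Definition definable {M : set_structure} (Q : (nat -> M) -> Prop) : Prop :=
  exists φ : formula, forall ρ : nat -> M, sat ρ φ <-> Q ρ.

Lemma definable_mem (M : set_structure) (i j : nat) :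
  definable (fun e : nat -> M => e i ∈ e j).
Proof. exists (FMem i j); simpl; tauto. Qed.

Lemma definable_eq (M : set_structure) (i j : nat) :
  definable (fun e : nat -> M => e i = e j).
Proof. exists (FEq i j); simpl; tauto. Qed.

Lemma definable_imp (M : set_structure) (Q R : (nat -> M) -> Prop) :
  definable Q -> definable R -> definable (fun e => Q e -> R e).
Proof.
  intros [φ Hφ] [ψ Hψ]; exists (FImp φ ψ); intro ρ; simpl.
  rewrite (Hφ ρ), (Hψ ρ); tauto.
Qed.

Lemma definable_not (M : set_structure) (Q : (nat -> M) -> Prop) :
  definable Q -> definable (fun e => ~ Q e).
Proof.
  intros [φ Hφ]; exists (FImp φ FBot); intro ρ; simpl.
  rewrite (Hφ ρ); tauto.
Qed.

Lemma definable_and (M : set_structure) (Q R : (nat -> M) -> Prop) :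
  definable Q -> definable R -> definable (fun e => Q e /\ R e).
Proof.
  intros [φ Hφ] [ψ Hψ]; exists (FAnd φ ψ); intro ρ; simpl.
  rewrite (Hφ ρ), (Hψ ρ); tauto.
Qed.

Lemma definable_or (M : set_structure) (Q R : (nat -> M) -> Prop) :
  definable Q -> definable R -> definable (fun e => Q e \/ R e).
Proof.
  intros [φ Hφ] [ψ Hψ]; exists (FOr φ ψ); intro ρ; simpl.
  rewrite (Hφ ρ), (Hψ ρ); tauto.
Qed.

(** The bound element enters at index 0 and the parameters move up by one; shifting [scons x ρ] back
    gives [ρ] by computation. *)
Lemma definable_all (M : set_structure) (Q : (nat -> M) -> M -> Prop) :
  definable (fun e => Q (fun n => e (S n)) (e 0)) ->
  definable (fun e => forall x : M, Q e x).
Proof.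
  intros [φ Hφ]; exists (FAll φ); intro ρ; simpl; split; intros H x.
  - exact (proj1 (Hφ (scons x ρ)) (H x)).
  - exact (proj2 (Hφ (scons x ρ)) (H x)).
Qed.

Lemma definable_ex (M : set_structure) (Q : (nat -> M) -> M -> Prop) :
  definable (fun e => Q (fun n => e (S n)) (e 0)) ->
  definable (fun e => exists x : M, Q e x).
Proof.
  intros [φ Hφ]; exists (FEx φ); intro ρ; simpl; split; intros [x H]; exists x.
  - exact (proj1 (Hφ (scons x ρ)) H).
  - exact (proj2 (Hφ (scons x ρ)) H).
Qed.

Ltac definability :=
  unfold iff, compatible, related, is_opair, is_upair, is_empty,
    is_successor, subset;
  cbv beta;
  repeat (first
    [ apply definable_mem | apply definable_eq | apply definable_not
    | apply definable_and | apply definable_or | apply definable_imp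
    | apply definable_all | apply definable_ex ]; cbv beta).

(** In [Q] index 0 is the tested element and parameters start at index 1. In valuations such as
    [scons A (fun _ => B)] the constant tail supplies the last parameter; later indices are never
    read. *)
Lemma separation {M : set_structure} (hZF : ZF M) (Q : (nat -> M) -> Prop) :
  definable Q -> forall (ρ : nat -> M) (a : M), exists b : M,
  forall x : M, x ∈ b <-> x ∈ a /\ Q (scons x ρ).
Proof.
  intros [φ Hφ] ρ a.
  destruct (ZF_separation hZF φ ρ a) as [b Hb].
  exists b; intro x; rewrite (Hb x), (Hφ (scons x ρ)); tauto.
Qed.

(** * Pairs and products *)

Lemma upair_inj (M : set_structure) (a b c d p : M) :
  is_upair a b p -> is_upair c d p -> (a = c /\ b = d) \/ (a = d /\ b = c).
Proof.
  intros H K.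
  pose proof (proj1 (K a) (proj2 (H a) (or_introl eq_refl))).
  pose proof (proj1 (K b) (proj2 (H b) (or_intror eq_refl))).
  pose proof (proj1 (H c) (proj2 (K c) (or_introl eq_refl))).
  pose proof (proj1 (H d) (proj2 (K d) (or_intror eq_refl))).
  intuition congruence.
Qed.

Lemma upair_unique (M : set_structure) (hZF : ZF M) (a b p q : M) :
  is_upair a b p -> is_upair a b q -> p = q.
Proof.
  intros H K; apply (ZF_extensionality hZF); intro x.
  rewrite (H x), (K x); tauto.
Qed.

Lemma opair_exists (M : set_structure) (hZF : ZF M) (a b : M) :
  exists p : M, is_opair a b p.
Proof.
  destruct (ZF_pairing hZF a a) as [s Hs].
  destruct (ZF_pairing hZF a b) as [d Hd].
  destruct (ZF_pairing hZF s d) as [p Hp].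
  exists p, s, d; auto.
Qed.

Lemma opair_unique (M : set_structure) (hZF : ZF M) (a b p q : M) :
  is_opair a b p -> is_opair a b q -> p = q.
Proof.
  intros (s & d & Hs & Hd & Hp) (s' & d' & Hs' & Hd' & Hq).
  rewrite (upair_unique hZF Hs' Hs), (upair_unique hZF Hd' Hd) in Hq.
  exact (upair_unique hZF Hp Hq).
Qed.

Lemma opair_inj (M : set_structure) (a b c d p : M) :
  is_opair a b p -> is_opair c d p -> a = c /\ b = d.
Proof.
  intros (s & t & Hs & Ht & Hp) (s' & t' & Hs' & Ht' & Hp').
  destruct (upair_inj Hp Hp') as [[-> ->] | [-> ->]].
  - pose proof (upair_inj Hs Hs'); pose proof (upair_inj Ht Ht').
    intuition congruence.
  (* Crossed case: {a} = {c, d} and {a, b} = {c}, so all four components coincide. *)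
  - pose proof (upair_inj Hs Ht'); pose proof (upair_inj Ht Hs').
    intuition congruence.
Qed.

Lemma related_opair (M : set_structure) (hZF : ZF M) (R a b p : M) :
  is_opair a b p -> (related R a b <-> p ∈ R).
Proof.
  intro Hp; split.
  - intros (q & Hq & HR); rewrite (opair_unique hZF Hp Hq); exact HR.
  - intro HR; exists p; auto.
Qed.

(** A Kuratowski pair over A and B is a set of subsets of A ∪ B, so the product is cut out of the
    double power set of A ∪ B. *)
Lemma product_exists (M : set_structure) (hZF : ZF M) (A B : M) :
  exists C : M, forall p : M,
  p ∈ C <-> exists a b : M, a ∈ A /\ b ∈ B /\ is_opair a b p.
Proof.
  destruct (ZF_pairing hZF A B) as [c Hc].
  destruct (ZF_union hZF c) as [u Hu].
  destruct (ZF_powerset hZF u) as [v Hv].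
  destruct (ZF_powerset hZF v) as [w Hw].
  destruct (separation hZF
    (Q := fun e => exists a b : M, a ∈ e 1 /\ b ∈ e 2 /\ is_opair a b (e 0))
    ltac:(definability) (scons A (fun _ => B)) w) as [C HC].
  cbn in HC.
  exists C; intro p; rewrite (HC p); split; [tauto |].
  intros (a & b & Ha & Hb & Hp); split; [| exists a, b; auto].
  assert (Hau : a ∈ u) by (apply Hu; exists A; split; [apply Hc |]; auto).
  assert (Hbu : b ∈ u) by (apply Hu; exists B; split; [apply Hc |]; auto).
  destruct Hp as (s & d & Hs & Hd & Hp).
  apply Hw; intros y Hy; apply Hv; intros z Hz.
  apply Hp in Hy; destruct Hy as [-> | ->].
  - apply Hs in Hz; destruct Hz as [-> | ->]; auto.
  - apply Hd in Hz; destruct Hz as [-> | ->]; auto.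
Qed.

(** In [Q], indices 0 and 1 are the second and the first component; index 2 would
    be the pair itself, so the parameters start at index 3. *)
Lemma relation_exists (M : set_structure) (hZF : ZF M)
  (Q : (nat -> M) -> M -> M -> Prop) :
  definable (fun e => Q (fun n => e (S (S (S n)))) (e 1) (e 0)) ->
  forall (ρ : nat -> M) (A B : M), exists R : M,
    (forall p : M, p ∈ R -> exists a b : M, a ∈ A /\ b ∈ B /\ is_opair a b p) /\
    (forall a b : M, related R a b <-> a ∈ A /\ b ∈ B /\ Q ρ a b).
Proof.
  intros HQ ρ A B.
  destruct (product_exists hZF A B) as [C HC].
  assert (Hdef : definable (fun e : nat -> M => exists a b : M,
    is_opair a b (e 0) /\ Q (fun n => e (S n)) a b)).
  { apply definable_ex, definable_ex, definable_and; [definability | exact HQ]. }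
  destruct (separation hZF Hdef ρ C) as [R HR]; cbn in HR.
  exists R; split.
  - intros p Hp; apply HC, HR, Hp.
  - intros a b; destruct (opair_exists hZF a b) as [p Hp].
    rewrite (related_opair hZF _ Hp), (HR p), (HC p); split.
    + intros [(a' & b' & Ha & Hb & Hp') (a'' & b'' & Hp'' & H)].
      destruct (opair_inj Hp Hp') as [-> ->].
      destruct (opair_inj Hp' Hp'') as [-> ->]; auto.
    + intros (Ha & Hb & H); split; exists a, b; auto.
Qed.

(** * Natural numbers *)

Lemma successor_exists (M : set_structure) (hZF : ZF M) (a : M) :
  exists s : M, is_successor a s.
Proof.
  destruct (ZF_pairing hZF a a) as [t Ht].
  destruct (ZF_pairing hZF a t) as [c Hc].
  destruct (ZF_union hZF c) as [s Hs].
  exists s; intro x; rewrite (Hs x); split.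
  - intros (y & Hy & Hx); apply Hc in Hy; destruct Hy as [-> | ->]; auto.
    apply Ht in Hx; tauto.
  - intros [Hx | ->].
    + exists a; split; [apply Hc |]; auto.
    + exists t; split; [apply Hc | apply Ht]; auto.
Qed.

Definition is_inductive (M : set_structure) (I : M) : Prop :=
  (forall e : M, is_empty e -> e ∈ I) /\
  (forall n s : M, n ∈ I -> is_successor n s -> s ∈ I).

Definition is_omega (M : set_structure) (W : M) : Prop :=
  is_inductive W /\ forall I : M, is_inductive I -> subset W I.

Lemma omega_exists (M : set_structure) (hZF : ZF M) :
  exists W : M, is_omega W.
Proof.
  destruct (ZF_infinity hZF) as (w & (z & Hz & Hzw) & Hw).
  (* Infinity gives some empty set and some successors in [w]; by extensionality there are no
     others. *)
  assert (Hind : is_inductive w).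
  { split.
    - intros e He; replace e with z; auto.
      apply (ZF_extensionality hZF); intro x; split; intro H;
        [destruct (Hz x H) | destruct (He x H)].
    - intros n s Hn Hs; destruct (Hw n Hn) as (s' & Hs' & Hsw).
      replace s with s'; auto.
      apply (ZF_extensionality hZF); intro x; rewrite (Hs x), (Hs' x); tauto. }
  destruct (separation hZF (Q := fun e => forall I : M, is_inductive I -> e 0 ∈ I)
    ltac:(unfold is_inductive; definability) (fun _ => w) w) as [W HW].
  cbn in HW.
  exists W; split; [split |].
  - intros e He; apply HW; split; [apply Hind, He | intros I HI; apply HI, He].
  - intros n s Hn Hs; apply HW in Hn; destruct Hn as [Hn HnI]; apply HW; split.
    + exact (proj2 Hind n s Hn Hs).
    + intros I HI; exact (proj2 HI n s (HnI I HI) Hs).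
  - intros I HI n Hn; apply HW in Hn; apply Hn, HI.
Qed.

Lemma omega_ind (M : set_structure) (hZF : ZF M) (W : M) (hW : is_omega W)
  (Q : (nat -> M) -> Prop) (hQ : definable Q) (ρ : nat -> M) :
  (forall e : M, is_empty e -> Q (scons e ρ)) ->
  (forall n s : M, n ∈ W -> is_successor n s ->
     Q (scons n ρ) -> Q (scons s ρ)) ->
  forall n : M, n ∈ W -> Q (scons n ρ).
Proof.
  intros H0 HS n Hn.
  destruct (separation hZF hQ ρ W) as [I HI].
  destruct hW as [[W0 WS] Wmin].
  apply (HI n), Wmin; [split | exact Hn].
  - intros e He; apply HI; auto.
  - intros m s Hm Hs; apply HI in Hm; destruct Hm as [Hm HQ].
    apply HI; split; [apply (WS m) | apply (HS m)]; auto.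
Qed.

Lemma omega_transitive (M : set_structure) (hZF : ZF M) (W : M)
  (hW : is_omega W) (n : M) :
  n ∈ W -> forall m : M, m ∈ n -> subset m n.
Proof.
  revert n.
  refine (omega_ind hZF hW (Q := fun e => forall m : M, m ∈ e 0 -> subset m (e 0))
    ltac:(definability) (ρ := fun _ => W) _ _); cbn.
  - intros e He m Hm; destruct (He m Hm).
  - intros n s _ Hs IH m Hm x Hx; apply Hs; left.
    apply Hs in Hm; destruct Hm as [Hm | ->]; [exact (IH m Hm x Hx) | exact Hx].
Qed.

Lemma omega_zero_mem (M : set_structure) (hZF : ZF M) (W : M)
  (hW : is_omega W) (z : M) (hz : is_empty z) (n : M) :
  n ∈ W -> z = n \/ z ∈ n.
Proof.
  revert n.
  refine (omega_ind hZF hW (Q := fun e => e 1 = e 0 \/ e 1 ∈ e 0)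
    ltac:(definability) (ρ := fun _ => z) _ _); cbn.
  - intros e He; left; apply (ZF_extensionality hZF); intro x; split; intro H;
      [destruct (hz x H) | destruct (He x H)].
  - intros n s _ Hs [H | H]; right; apply Hs; auto.
Qed.

Lemma omega_successor_mem (M : set_structure) (hZF : ZF M) (W : M)
  (hW : is_omega W) (n : M) :
  n ∈ W -> forall m s : M, m ∈ n -> is_successor m s -> s = n \/ s ∈ n.
Proof.
  revert n.
  refine (omega_ind hZF hW (Q := fun e => forall m s : M,
    m ∈ e 0 -> is_successor m s -> s = e 0 \/ s ∈ e 0)
    ltac:(definability) (ρ := fun _ => W) _ _); cbn.
  - intros e He m s Hm; destruct (He m Hm).
  - intros n t _ Ht IH m s Hm Hs; apply Ht in Hm; destruct Hm as [Hm | ->].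
    + right; apply Ht; destruct (IH m s Hm Hs); auto.
    + left; apply (ZF_extensionality hZF); intro x.
      rewrite (Hs x), (Ht x); tauto.
Qed.

(** Induction on m: [omega_zero_mem] is the base case, and [omega_successor_mem] handles the step
    when m ∈ n. *)
Lemma omega_trichotomy (M : set_structure) (hZF : ZF M) (W : M)
  (hW : is_omega W) (m : M) :
  m ∈ W -> forall n : M, n ∈ W -> m = n \/ m ∈ n \/ n ∈ m.
Proof.
  revert m.
  refine (omega_ind hZF hW (Q := fun e => forall n : M,
    n ∈ e 1 -> e 0 = n \/ e 0 ∈ n \/ n ∈ e 0)
    ltac:(definability) (ρ := fun _ => W) _ _); cbn.
  - intros e He n Hn; destruct (omega_zero_mem hZF hW He Hn); auto.
  - intros m s _ Hs IH n Hn; destruct (IH n Hn) as [-> | [H | H]].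
    + right; right; apply Hs; auto.
    + destruct (omega_successor_mem hZF hW Hn H Hs); auto.
    + right; right; apply Hs; auto.
Qed.

(** The successor of the larger number works. This yields common lower bounds inside one summand x ×
    ω. *)
Lemma omega_directed (M : set_structure) (hZF : ZF M) (W : M)
  (hW : is_omega W) (m n : M) :
  m ∈ W -> n ∈ W -> exists k : M, k ∈ W /\ m ∈ k /\ n ∈ k.
Proof.
  intros Hm Hn.
  destruct (successor_exists hZF m) as [s Hs].
  destruct (successor_exists hZF n) as [t Ht].
  pose proof (proj2 (proj1 hW) m s Hm Hs).
  pose proof (proj2 (proj1 hW) n t Hn Ht).
  destruct (omega_trichotomy hZF hW Hm Hn) as [<- | [E | E]].
  - exists s; repeat split; auto; apply Hs; auto.
  - exists t; repeat split; auto; apply Ht; auto.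
  - exists s; repeat split; auto; apply Hs; auto.
Qed.

Lemma mem_irrefl (M : set_structure) (hZF : ZF M) (a : M) : ~ a ∈ a.
Proof.
  intro H.
  destruct (ZF_pairing hZF a a) as [s Hs].
  destruct (ZF_foundation hZF (a := s)) as (x & Hx & Hmin).
  - exists a; apply Hs; auto.
  - apply Hmin; exists a.
    assert (x = a) as -> by (apply Hs in Hx; tauto).
    split; [exact H | apply Hs; auto].
Qed.

(** * Choice from maximal antichains *)

Definition is_triple (M : set_structure) (x a n p : M) : Prop :=
  exists q : M, is_opair a n q /\ is_opair x q p.

Lemma triple_exists (M : set_structure) (hZF : ZF M) (x a n : M) :
  exists p : M, is_triple x a n p.
Proof.
  destruct (opair_exists hZF a n) as [q Hq].
  destruct (opair_exists hZF x q) as [p Hp].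
  exists p, q; auto.
Qed.

Lemma triple_inj (M : set_structure) (x a n y b m p : M) :
  is_triple x a n p -> is_triple y b m p -> x = y /\ a = b /\ n = m.
Proof.
  intros (q & Hq & Hp) (q' & Hq' & Hp').
  destruct (opair_inj Hp Hp') as [-> ->].
  destruct (opair_inj Hq Hq') as [-> ->]; auto.
Qed.

(** Cut out of X × (⋃X × W), since a ∈ x ∈ X gives a ∈ ⋃X. The component x tags the summand. *)
Lemma pointed_product_exists (M : set_structure) (hZF : ZF M) (X W : M) :
  exists P : M, forall p : M, p ∈ P <->
  exists x a n : M, x ∈ X /\ a ∈ x /\ n ∈ W /\ is_triple x a n p.
Proof.
  destruct (ZF_union hZF X) as [U HU].
  destruct (product_exists hZF U W) as [C HC].
  destruct (product_exists hZF X C) as [D HD].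
  destruct (separation hZF (Q := fun e => exists x a n : M,
      x ∈ e 1 /\ a ∈ x /\ n ∈ e 2 /\ is_triple x a n (e 0))
    ltac:(unfold is_triple; definability) (scons X (fun _ => W)) D) as [P HP].
  cbn in HP.
  exists P; intro p; rewrite (HP p); split; [tauto |].
  intros (x & a & n & Hx & Ha & Hn & Hp); split; [| exists x, a, n; auto].
  destruct Hp as (q & Hq & Hp).
  apply HD; exists x, q; split; [exact Hx | split; [| exact Hp]].
  apply HC; exists a, n; split; [| auto].
  apply HU; exists x; auto.
Qed.

(** A larger level lies lower. The components a and b are left unrelated, so that points with
    different a can share a lower bound. *)
Definition level_lt (M : set_structure) (p q : M) : Prop :=
  exists x a b n m : M, is_triple x a n p /\ is_triple x b m q /\ m ∈ n.

Lemma choice_of_maximal_antichains (M : set_structure) (hZF : ZF M) :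
  maximal_antichain_principle M -> axiom_of_choice M.
Proof.
  intros Hmax X HX.
  destruct (omega_exists hZF) as [W HW].
  destruct (pointed_product_exists hZF X W) as [P HP].
  destruct (relation_exists hZF (Q := fun _ p q => p = q \/ level_lt p q)
    ltac:(unfold level_lt, is_triple; definability) (fun _ => P) P P)
    as (L & HLP & HL).
  assert (Hord : is_partial_order P L).
  { split; [exact HLP | split; [| split]].
    - intros p Hp; apply HL; auto.
    - intros p q _ _ Hpq Hqp; apply HL in Hpq; apply HL in Hqp.
      destruct Hpq as (Hp & Hq & [E | (x & a & b & n & m & Tp & Tq & Hmn)]); auto.
      destruct Hqp as (_ & _ & [E | (x' & a' & b' & n' & m' & Tq' & Tp' & Hmn')]);
        auto.
      destruct (triple_inj Tp Tp') as (<- & <- & <-).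
      destruct (triple_inj Tq Tq') as (_ & <- & <-).
      (* Membership of [p] in [P] puts n in ω; then m ∈ n and n ∈ m give n ∈ n by transitivity. *)
      apply HP in Hp; destruct Hp as (y & c & k & _ & _ & Hk & Tp'').
      destruct (triple_inj Tp Tp'') as (<- & <- & <-).
      destruct (mem_irrefl hZF (omega_transitive hZF HW Hk Hmn Hmn')).
    - intros p q r Hp Hq Hr Hpq Hqr; apply HL in Hpq; apply HL in Hqr; apply HL.
      split; [exact Hp | split; [exact Hr |]].
      destruct Hpq as (_ & _ & [-> | (x & a & b & n & m & Tp & Tq & Hmn)]);
        [tauto |].
      destruct Hqr as (_ & _ & [<- | (x' & b' & c & m' & k & Tq' & Tr & Hkm)]);
        right; [exists x, a, b, n, m; auto |].
      destruct (triple_inj Tq Tq') as (<- & <- & <-).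
      exists x, a, c, n, k; split; [exact Tp | split; [exact Tr |]].
      apply HP in Hp; destruct Hp as (y & d & j & _ & _ & Hj & Tp').
      destruct (triple_inj Tp Tp') as (<- & <- & <-).
      exact (omega_transitive hZF HW Hj Hmn Hkm). }
  assert (Hcomp : forall x a n p b m q : M, x ∈ X ->
    a ∈ x -> n ∈ W -> is_triple x a n p ->
    b ∈ x -> m ∈ W -> is_triple x b m q -> compatible P L p q).
  { intros x a n p b m q Hx Ha Hn Tp Hb Hm Tq.
    destruct (omega_directed hZF HW Hn Hm) as (k & Hk & Hnk & Hmk).
    (* The bound (x, (a, k)) also lies below the point over b, because [level_lt] compares levels
       only. *)
    destruct (triple_exists hZF x a k) as [r Tr].
    assert (Hr : r ∈ P) by (apply HP; exists x, a, k; auto).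
    exists r; split; [exact Hr |]; split; apply HL; (split; [exact Hr |]).
    - split; [apply HP; exists x, a, n; auto |].
      right; exists x, a, a, k, n; auto.
    - split; [apply HP; exists x, b, m; auto |].
      right; exists x, a, b, k, m; auto. }
  (* Comparable points lie in the same summand, so compatible ones do too. *)
  assert (Hfirst : forall r p x y a b n m : M, related L r p ->
    is_triple x a n r -> is_triple y b m p -> x = y).
  { intros r p x y a b n m Hrp Tr Tp; apply HL in Hrp.
    destruct Hrp as (_ & _ & [<- | (z & c & d & k & l & Tr' & Tp' & _)]).
    - apply (triple_inj Tr Tp).
    - destruct (triple_inj Tr Tr') as (-> & _ & _).
      destruct (triple_inj Tp Tp') as (-> & _ & _); reflexivity. }
  destruct (Hmax P L Hord) as (A & (HAP & HA) & HAmax).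
  destruct (ZF_union hZF X) as [U HU].
  destruct (relation_exists hZF (Q := fun e x a => exists n p : M,
      is_triple x a n p /\ p ∈ e 0)
    ltac:(unfold is_triple; definability) (fun _ => A) X U) as (f & HfX & Hf).
  assert (Hmem : forall x a n p : M, is_triple x a n p -> p ∈ A ->
    x ∈ X /\ a ∈ x /\ n ∈ W).
  { intros x a n p Tp Hp.
    apply HAP, HP in Hp; destruct Hp as (y & b & m & Hy & Hb & Hm & Tp').
    destruct (triple_inj Tp Tp') as (-> & -> & ->); auto. }
  exists f; split; [split |].
  - intros p Hp; destruct (HfX p Hp) as (x & a & Hx & _ & Hxa); exists x, a; auto.
  - intros x Hx.
    assert (exists a : M, a ∈ x) as [a Ha].
    { apply NNPP; intro H; apply (HX x Hx); intros a Ha; apply H; exists a; exact Ha. }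
    assert (exists n : M, n ∈ W) as [n Hn].
    { destruct (ZF_infinity hZF) as (w & (z & Hz & _) & _).
      exists z; exact (proj1 (proj1 HW) z Hz). }
    (* Any point over x will do: the element [q] of [A] compatible with it lies over the same x. *)
    destruct (triple_exists hZF x a n) as [p Tp].
    destruct (HAmax p) as (q & Hq & r & Hr & Hrp & Hrq).
    { apply HP; exists x, a, n; auto. }
    pose proof (HAP q Hq) as HqP; apply HP in HqP.
    destruct HqP as (y & b & m & Hy & Hb & Hm & Tq).
    apply HP in Hr; destruct Hr as (z & c & k & _ & _ & _ & Tr).
    assert (z = x) as -> by exact (Hfirst _ _ _ _ _ _ _ _ Hrp Tr Tp).
    assert (x = y) as <- by exact (Hfirst _ _ _ _ _ _ _ _ Hrq Tr Tq).
    exists b; split.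
    + apply Hf; split; [exact Hx | split; [apply HU; exists x; auto |]].
      exists m, q; auto.
    + intros b' Hb'; apply Hf in Hb'; destruct Hb' as (_ & _ & m' & q' & Tq' & Hq').
      destruct (Hmem _ _ _ _ Tq' Hq') as (_ & Hb'x & Hm').
      (* Distinct [q] and [q'] in [A] over the same x would be compatible by [Hcomp]. *)
      destruct (classic (q = q')) as [<- | Hne].
      * apply (triple_inj Tq Tq').
      * destruct (HA q q' Hq Hq' Hne); eauto.
  - intros x a Hx Ha; apply Hf in Ha; destruct Ha as (_ & _ & n & p & Tp & Hp).
    apply (Hmem _ _ _ _ Tp Hp).
Qed.

(** * Maximal antichains from choice *)

(** [N] codes the step as a set of pairs (A, x), x being a point to add to A. Where A has no such x,
    the step leaves A unchanged. *)
Definition is_extension (M : set_structure) (N A B : M) : Prop :=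
  forall x : M, x ∈ B <-> x ∈ A \/ related N A x.

Definition is_union (M : set_structure) (C U : M) : Prop :=
  forall x : M, x ∈ U <-> exists c : M, c ∈ C /\ x ∈ c.

(** The union clause with C empty puts the empty set into T, so inductions over the tower have no
    separate base case. *)
Definition tower_closed (M : set_structure) (N T : M) : Prop :=
  (forall A B : M, A ∈ T -> is_extension N A B -> B ∈ T) /\
  (forall C U : M, subset C T -> is_union C U -> U ∈ T).

Definition is_tower (M : set_structure) (P N T : M) : Prop :=
  (forall t : M, t ∈ T -> subset t P) /\ tower_closed N T /\
  forall S : M, tower_closed N S -> subset T S.

(** The power set of P is closed because [N] takes values in P; inside it, the intersection of all
    closed sets is the tower. *)
Lemma tower_exists (M : set_structure) (hZF : ZF M) (P N : M) :
  (forall A x : M, related N A x -> x ∈ P) -> exists T : M, is_tower P N T.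
Proof.
  intro HN.
  destruct (ZF_powerset hZF P) as [V HV].
  assert (HVc : tower_closed N V).
  { split.
    - intros A B HA HB; apply HV; intros x Hx; apply HB in Hx.
      destruct Hx as [Hx | Hx]; [exact (proj1 (HV A) HA x Hx) | exact (HN A x Hx)].
    - intros C U HC HU; apply HV; intros x Hx; apply HU in Hx.
      destruct Hx as (c & Hc & Hx); exact (proj1 (HV c) (HC c Hc) x Hx). }
  destruct (separation hZF (Q := fun e => forall S : M,
      tower_closed (e 1) S -> e 0 ∈ S)
    ltac:(unfold tower_closed, is_extension, is_union; definability)
    (fun _ => N) V) as [T HT].
  cbn in HT.
  exists T; split; [| split; [split |]].
  - intros t Ht; exact (proj1 (HV t) (proj1 (proj1 (HT t) Ht))).
  - intros A B HA HB; apply HT in HA; destruct HA as [HAV HA].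
    apply HT; split; [exact (proj1 HVc A B HAV HB) |].
    intros S HS; exact (proj1 HS A B (HA S HS) HB).
  - intros C U HC HU; apply HT; split.
    + apply (proj2 HVc C U); [intros c Hc; exact (proj1 (proj1 (HT c) (HC c Hc))) | exact HU].
    + intros S HS; apply (proj2 HS C U); [| exact HU].
      intros c Hc; exact (proj2 (proj1 (HT c) (HC c Hc)) S HS).
  - intros S HS t Ht; apply HT in Ht; apply Ht, HS.
Qed.

(** Minimality of T applied to the set of its members satisfying [Q]; hence both cases may also
    assume membership in T. *)
Lemma tower_ind (M : set_structure) (hZF : ZF M) (P N T : M)
  (hT : is_tower P N T) (Q : (nat -> M) -> Prop) (hQ : definable Q)
  (ρ : nat -> M) :
  (forall A B : M, A ∈ T -> B ∈ T -> is_extension N A B ->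
     Q (scons A ρ) -> Q (scons B ρ)) ->
  (forall C U : M, subset C T -> U ∈ T -> is_union C U ->
     (forall c : M, c ∈ C -> Q (scons c ρ)) -> Q (scons U ρ)) ->
  forall t : M, t ∈ T -> Q (scons t ρ).
Proof.
  intros Hext Huni t Ht.
  destruct (separation hZF hQ ρ T) as [S HS].
  destruct hT as (_ & [Text Tuni] & Tmin).
  apply (HS t), Tmin; [split | exact Ht].
  - intros A B HA HB; apply HS in HA; destruct HA as [HA HQA].
    assert (B ∈ T) by exact (Text A B HA HB).
    apply HS; split; [| apply (Hext A B)]; auto.
  - intros C U HC HU.
    assert (subset C T) by (intros c Hc; apply HS, HC, Hc).
    assert (U ∈ T) by (apply (Tuni C U); auto).
    apply HS; split; [| apply (Huni C U)]; auto.
    intros c Hc; apply HS, HC, Hc.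
Qed.

(** Expresses that the extension of A is contained in B without having to name that extension. *)
Definition extends_within (M : set_structure) (N A B : M) : Prop :=
  subset A B /\ forall x : M, related N A x -> x ∈ B.

Lemma extends_within_extension (M : set_structure) (N A A' B : M) :
  is_extension N A A' -> (extends_within N A B <-> subset A' B).
Proof.
  intro HA'; split.
  - intros [HAB HN] x Hx; apply HA' in Hx; destruct Hx; auto.
  - intro H; split; intros x Hx; apply H, HA'; auto.
Qed.

(** The extreme points of the proof of the Bourbaki–Witt theorem: the extension
    step cannot jump over [c]. *)
Definition is_extreme (M : set_structure) (N T c : M) : Prop :=
  forall A : M, A ∈ T -> subset A c -> A <> c -> extends_within N A c.

(** Induction on A. If A is strictly inside c, extremeness keeps its extension inside c; if A = c,
    its extension is that of c. A union either has a member containing the extension of c or has all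
    members inside c. *)
Lemma extreme_comparable (M : set_structure) (hZF : ZF M) (P N T : M)
  (hT : is_tower P N T) (c : M) (hc : is_extreme N T c) (A : M) :
  A ∈ T -> subset A c \/ extends_within N c A.
Proof.
  revert A.
  refine (tower_ind hZF hT
    (Q := fun e => subset (e 0) (e 1) \/ extends_within (e 2) (e 1) (e 0))
    ltac:(unfold extends_within; definability)
    (ρ := scons c (fun _ => N)) _ _); cbn.
  - intros A B HA _ HB [H | [Hc HN]].
    + destruct (classic (A = c)) as [-> | Hne].
      * right; apply (extends_within_extension B HB); intros x Hx; exact Hx.
      * left; apply (extends_within_extension c HB), hc; auto.
    + right; split; intros x Hx; apply HB; auto.
  - intros C U _ _ HU IH.
    destruct (classic (exists d : M, d ∈ C /\ extends_within N c d))
      as [(d & Hd & Hcd & HN) | Hno].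
    + right; split; intros x Hx; apply HU; exists d; auto.
    + left; intros x Hx; apply HU in Hx; destruct Hx as (d & Hd & Hx).
      destruct (IH d Hd) as [H | H]; [exact (H x Hx) |].
      destruct Hno; exists d; auto.
Qed.

(** Induction on c: the induction hypothesis makes earlier points extreme, so [extreme_comparable]
    places A relative to them. *)
Lemma tower_extreme (M : set_structure) (hZF : ZF M) (P N T : M)
  (hT : is_tower P N T) (c : M) :
  c ∈ T -> is_extreme N T c.
Proof.
  revert c.
  refine (tower_ind hZF hT (Q := fun e => is_extreme (e 2) (e 1) (e 0))
    ltac:(unfold is_extreme, extends_within; definability)
    (ρ := scons T (fun _ => N)) _ _); cbn.
  - intros c B Hc _ HB IH A HA HAB Hne.
    destruct (extreme_comparable hZF hT IH HA) as [HAc | HcA].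
    + assert (HcB : subset c B) by (intros x Hx; apply HB; auto).
      destruct (classic (A = c)) as [-> | Hne'].
      * apply (extends_within_extension B HB); intros x Hx; exact Hx.
      * destruct (IH A HA HAc Hne') as [_ HN]; split; auto.
    (* Here the extension [B] of c lies inside [A], so A = B, against strictness. *)
    + destruct Hne; apply (ZF_extensionality hZF); intro x; split; [apply HAB |].
      apply (extends_within_extension A HB), HcA.
  - intros C U HC _ HU IH A HA HAU Hne.
    (* If every member of [C] were inside [A], then A would equal the union [U]. *)
    assert (exists c : M, c ∈ C /\ ~ subset c A) as (c & Hc & HcA).
    { apply NNPP; intro Hno; apply Hne, (ZF_extensionality hZF); intro x.
      split; [apply HAU |].
      intro Hx; apply HU in Hx; destruct Hx as (c & Hc & Hx).
      apply NNPP; intro HxA; apply Hno; exists c; split; [exact Hc |].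
      intro H; exact (HxA (H x Hx)). }
    destruct (extreme_comparable hZF hT (IH c Hc) HA) as [HAc | [H _]];
      [| contradiction].
    assert (HAne : A <> c) by (intros ->; apply HcA; intros x Hx; exact Hx).
    destruct (IH c Hc A HA HAc HAne) as [_ HN].
    split; [exact HAU |].
    intros x Hx; apply HU; exists c; auto.
Qed.

Lemma tower_chain (M : set_structure) (hZF : ZF M) (P N T : M)
  (hT : is_tower P N T) (A B : M) :
  A ∈ T -> B ∈ T -> subset A B \/ subset B A.
Proof.
  intros HA HB.
  destruct (extreme_comparable hZF hT (tower_extreme hZF hT HB) HA) as [H | [H _]];
    auto.
Qed.

(** The union of T is in T, hence so is its extension, which is therefore contained in that
    union. *)
Lemma tower_fixpoint (M : set_structure) (hZF : ZF M) (P N T : M)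
  (hT : is_tower P N T) :
  (forall A x : M, related N A x -> x ∈ P) ->
  exists U : M, U ∈ T /\ forall x : M, related N U x -> x ∈ U.
Proof.
  intro HN.
  destruct (ZF_union hZF T) as [U HU].
  destruct hT as (HTP & [Text Tuni] & _).
  assert (HUT : U ∈ T) by (apply (Tuni T U); [intros x Hx; exact Hx | exact HU]).
  destruct (separation hZF (Q := fun e => e 0 ∈ e 1 \/ related (e 2) (e 1) (e 0))
    ltac:(definability) (scons U (fun _ => N)) P) as [B HB].
  cbn in HB.
  assert (HBU : is_extension N U B).
  { intro x; rewrite (HB x); split; [tauto |].
    intros [Hx | Hx]; (split; [| tauto]).
    - exact (HTP U HUT x Hx).
    - exact (HN U x Hx). }
  exists U; split; [exact HUT |].
  intros x Hx; apply HU; exists B; split.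
  - exact (Text U B HUT HBU).
  - apply HBU; auto.
Qed.

(** The candidates for enlarging [A]: an antichain is maximal exactly when this set is empty. *)
Definition is_free_part (M : set_structure) (P L A E : M) : Prop :=
  forall p : M, p ∈ E <->
    p ∈ P /\ forall q : M, q ∈ A -> ~ compatible P L p q.

Lemma compatible_sym (M : set_structure) (P L p q : M) :
  compatible P L p q -> compatible P L q p.
Proof. intros (r & Hr & Hp & Hq); exists r; auto. Qed.

Lemma maximal_antichains_of_choice (M : set_structure) (hZF : ZF M) :
  axiom_of_choice M -> maximal_antichain_principle M.
Proof.
  intros AC P L (_ & Hrefl & _).
  destruct (ZF_powerset hZF P) as [V HV].
  destruct (separation hZF (Q := fun e => ~ is_empty (e 0))
    ltac:(definability) (fun _ => V) V) as [X HX]; cbn in HX.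
  destruct (AC X) as (f & [HfX Hf] & Hchoice).
  { intros x Hx; apply HX, Hx. }
  (* [N] sends A to the chosen element of its free part. It has no value where the free part is
     empty, since [f] is defined on nonempty sets only. *)
  destruct (relation_exists hZF (Q := fun e A x => exists E : M,
      is_free_part (e 0) (e 1) A E /\ related (e 2) E x)
    ltac:(unfold is_free_part; definability)
    (scons P (scons L (fun _ => f))) V P) as (N & _ & HN); cbn in HN.
  assert (HNP : forall A x : M, related N A x -> x ∈ P)
    by (intros A x H; apply HN in H; tauto).
  assert (Hfree : forall A : M, exists E : M, is_free_part P L A E).
  { intro A.
    destruct (separation hZF (Q := fun e => forall q : M,
        q ∈ e 1 -> ~ compatible (e 2) (e 3) (e 0) q)
      ltac:(definability) (scons A (scons P (fun _ => L))) P) as [E HE].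
    exists E; exact HE. }
  assert (Hdom : forall E x : M, related f E x -> E ∈ X).
  { intros E x (p & Hp & Hpf); destruct (HfX p Hpf) as (E' & y & HE' & Hp').
    destruct (opair_inj Hp Hp') as [-> _]; exact HE'. }
  assert (HNfree : forall A x : M, related N A x ->
    forall q : M, q ∈ A -> ~ compatible P L x q).
  { intros A x H; apply HN in H; destruct H as (_ & _ & E & HE & Hx).
    apply (HE x), (Hchoice E); eauto. }
  (* Each step must add at most one point, as two new points could be compatible with each other. *)
  assert (HNfun : forall A x y : M, related N A x -> related N A y -> x = y).
  { intros A x y Hx Hy; apply HN in Hx; apply HN in Hy.
    destruct Hx as (_ & _ & E & HE & Hx); destruct Hy as (_ & _ & E' & HE' & Hy).
    assert (E' = E) as ->
      by (apply (ZF_extensionality hZF); intro p; rewrite (HE p), (HE' p); tauto).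
    destruct (Hf E (Hdom E x Hx)) as (z & _ & Hz).
    rewrite <- (Hz x Hx); exact (Hz y Hy). }
  destruct (tower_exists hZF HNP) as [T HT].
  assert (Hanti : forall A : M, A ∈ T -> is_antichain P L A).
  { intros A HA; split; [exact (proj1 HT A HA) |]; revert A HA.
    refine (tower_ind hZF HT (Q := fun e => forall p q : M,
        p ∈ e 0 -> q ∈ e 0 -> p <> q -> ~ compatible (e 1) (e 2) p q)
      ltac:(definability) (ρ := scons P (fun _ => L)) _ _); cbn.
    - intros A B _ _ HB IH p q Hp Hq Hne Hpq.
      apply HB in Hp; apply HB in Hq.
      destruct Hp as [Hp | Hp]; destruct Hq as [Hq | Hq].
      + exact (IH p q Hp Hq Hne Hpq).
      + exact (HNfree A q Hq p Hp (compatible_sym Hpq)).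
      + exact (HNfree A p Hp q Hq Hpq).
      + exact (Hne (HNfun A p q Hp Hq)).
    - intros C U HC _ HU IH p q Hp Hq.
      apply HU in Hp; destruct Hp as (c & Hc & Hp).
      apply HU in Hq; destruct Hq as (d & Hd & Hq).
      (* The larger of [c] and [d] contains both points. *)
      destruct (tower_chain hZF HT (HC c Hc) (HC d Hd)) as [H | H].
      + apply (IH d Hd); auto.
      + apply (IH c Hc); auto. }
  destruct (tower_fixpoint hZF HT HNP) as (A & HA & Hfix).
  exists A; split; [exact (Hanti A HA) |].
  intros p Hp; apply NNPP; intro Hno.
  destruct (Hfree A) as [E HE].
  assert (HEX : E ∈ X).
  { apply HX; split.
    - apply HV; intros x Hx; apply HE, Hx.
    - intro Hempty; apply (Hempty p), HE; split; [exact Hp |].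
      intros q Hq Hpq; apply Hno; exists q; auto. }
  destruct (Hf E HEX) as (x & Hx & _).
  assert (HxP : x ∈ P) by (apply (HE x), (Hchoice E); auto).
  assert (HAx : related N A x).
  { apply HN; split; [apply HV, HT, HA | split; [exact HxP | exists E; auto]]. }
  (* The point [x] is incompatible with all of [A], and by [Hfix] it is in [A]; but reflexivity
     makes it compatible with itself. *)
  apply (HNfree A x HAx x (Hfix x HAx)).
  exists x; auto.
Qed.

Theorem theorem1 (M : set_structure) (hZF : ZF M) :
  axiom_of_choice M <-> maximal_antichain_principle M.
Proof.
  split.
  - exact (maximal_antichains_of_choice hZF).
  - exact (choice_of_maximal_antichains hZF).
Qed.
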